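(* Let $\mathbf{A}$ be a fixed finite linearly ordered MTL-algebra, let $\mathcal{P}$ be a predicate language and let $T$ be a consistent theory. Then $Mod_{\mathbf{A}}(T)$ is closed under homomorphisms if and only if $T$ is axiomatized by a set of existential positive sentences, i.e. there is a set $\Sigma$ of existential positive $\mathcal{P}$-sentences with $Mod_{\mathbf{A}}(T)=Mod_{\mathbf{A}}(\Sigma)$.
   Context: MTL-algebras are the algebraic semantics of the logic MTL: bounded integral commutative residuated lattices satisfying prelinearity; $\&$ is interpreted by the monoidal operation, $\wedge$ by min, $\vee$ by max. A predicate language $\mathcal{P}$ consists of predicate and function symbols with arities and an equality symbol. An $\mathbf{A}$-structure $\mathbf{M}$ has a nonempty domain $M$, maps $P_{\mathbf{M}}:M^n\to A$ for $n$-ary predicate symbols, functions $F_{\mathbf{M}}:M^n\to M$ for $n$-ary function symbols, and equality interpreted as crisp identity. Truth values of formulas are computed recursively: connectives in $\mathbf{A}$, $\forall$ as minimum and $\exists$ as maximum over the domain. All structures are $\mathbf{A}$-structures. $\mathbf{M}$ is a model of $\Sigma$ if every sentence of $\Sigma$ has value $1$ in $\mathbf{M}$; $Mod_{\mathbf{A}}(\Sigma)$ is the class of such models; $T$ is axiomatized by $\Sigma$ if $Mod_{\mathbf{A}}(T)=Mod_{\mathbf{A}}(\Sigma)$. A theory is consistent if it does not derive $\overline{0}$ in the predicate logic MTL$\forall_=$. $T$ is closed under homomorphisms if whenever $\mathbf{M}$ is an $\mathbf{A}$-model of $T$ and $g$ is a homomorphism from $\mathbf{M}$ onto... to $\mathbf{N}$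 then — more precisely, whenever there is a homomorphism from a model of $T$ to a structure $\mathbf{N}$, then $\mathbf{N}$ is a model of $T$. A homomorphism from $\mathbf{M}$ to $\mathbf{N}$ is a map $g:M\to N$ commuting with all function symbols and such that $\|P(d_1,\dots,d_n)\|_{\mathbf{M}}=1$ implies $\|P(g(d_1),\dots,g(d_n))\|_{\mathbf{N}}=1$ for every predicate symbol $P$. An existential positive formula is a formula of the form $(\exists\bar x)\psi$ with $\psi$ quantifier-free and built from atomic formulas using only the connectives $\wedge$, $\vee$ and $\&$.
   Formalization: The truth constant 0 is admitted as an atomic formula in existential positive sentences; without it the claim fails for consistent theories having no model over A, e.g. {P→¬P, ¬P→P} over the two-element algebra. *)

(* Defs.v *)
From HB Require Import structures.
From mathcomp Require Import all_boot all_order.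
From mathcomp Require Import boolp classical_sets.

Set Implicit Arguments.
Unset Strict Implicit.
Unset Printing Implicit Defensive.

Local Open Scope classical_set_scope.
Local Open Scope order_scope.

(* Integrality of the residuated lattice is the fact that the unit of the     *)
(* monoidal operation is \top.                                                *)
HB.mixin Record isMTLAlgebra (d : Order.disp_t) A of Order.TBLattice d A := {
  mtl_mul : A -> A -> A;
  mtl_imp : A -> A -> A;
  mtl_mulA : associative mtl_mul;
  mtl_mulC : commutative mtl_mul;
  mtl_mul1x : left_id \top mtl_mul;
  mtl_residuation : forall x y z : A,
    (mtl_mul x y <= z) = (x <= mtl_imp y z);
  mtl_prelinearity : forall x y : A, mtl_imp x y `|` mtl_imp y x = \top
}.

#[short(type="mtlAlgebraType")]
HB.structure Definition MTLAlgebra (d : Order.disp_t) :=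
  {A of Order.TBLattice d A & isMTLAlgebra d A}.

#[short(type="finMTLChainType")]
HB.structure Definition FinMTLChain (d : Order.disp_t) :=
  {A of Order.FinTBTotal d A & isMTLAlgebra d A}.

Record language := Language {
  pred_symb : Type;
  pred_arity : pred_symb -> nat;
  fun_symb : Type;
  fun_arity : fun_symb -> nat
}.

(* Tuples of length n are functions on 'I_n; variables are natural numbers.   *)
Inductive term (L : language) : Type :=
| Var of nat
| App (f : fun_symb L) of ('I_(fun_arity f) -> term L).

(* Negation, equivalence and the constant 1 are the usual abbreviations.      *)
Inductive formula (L : language) : Type :=
| Bot
| Equal of term L & term L
| Pred (P : pred_symb L) of ('I_(pred_arity P) -> term L)
| And of formula L & formula L
| Or of formula L & formula L
| Tens of formula L & formula L
| Imp of formula L & formula L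
| Forall of nat & formula L
| Exists of nat & formula L.

Arguments Var {L} _.
Arguments Bot {L}.

Declare Scope formula_scope.
Delimit Scope formula_scope with F.
Bind Scope formula_scope with formula.
Notation "p /\ q" := (And p q) : formula_scope.
Notation "p \/ q" := (Or p q) : formula_scope.
Notation "p && q" := (Tens p q) : formula_scope.
Notation "p ==> q" := (Imp p q) : formula_scope.

Section Syntax.
Variable L : language.
Implicit Types (t u : term L) (p q r : formula L) (x y : nat).

Fixpoint occurs x t : bool :=
  match t with
  | Var y => x == y
  | App f ts => [exists i, occurs x (ts i)]
  end.

Fixpoint free x p : bool :=
  match p with
  | Bot => false
  | Equal t u => occurs x t || occurs x u
  | Pred P ts => [exists i, occurs x (ts i)]
  | And q r | Or q r | Tens q r | Imp q r => free x q || free x r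
  | Forall y q | Exists y q => (x != y) && free x q
  end.

Definition sentence p : Prop := forall x, ~~ free x p.

Definition is_theory (T : set (formula L)) : Prop :=
  forall p, T p -> sentence p.

Fixpoint tsubst x u t : term L :=
  match t with
  | Var y => if y == x then u else Var y
  | App f ts => App (fun i => tsubst x u (ts i))
  end.

(* Not capture avoiding: only used under the condition [substitutable].       *)
Fixpoint subst x u p : formula L :=
  match p with
  | Bot => Bot
  | Equal t t' => Equal (tsubst x u t) (tsubst x u t')
  | Pred P ts => Pred (fun i => tsubst x u (ts i))
  | And q r => And (subst x u q) (subst x u r)
  | Or q r => Or (subst x u q) (subst x u r)
  | Tens q r => Tens (subst x u q) (subst x u r)
  | Imp q r => Imp (subst x u q) (subst x u r)
  | Forall y q => Forall y (if y == x then q else subst x u q)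
  | Exists y q => Exists y (if y == x then q else subst x u q)
  end.

(* No free occurrence of x in p lies in the scope of a quantifier binding a   *)
(* variable of u.                                                             *)
Fixpoint substitutable x u p : bool :=
  match p with
  | Bot | Equal _ _ | Pred _ _ => true
  | And q r | Or q r | Tens q r | Imp q r =>
      substitutable x u q && substitutable x u r
  | Forall y q | Exists y q =>
      (x == y) || ~~ free x q || ~~ occurs y u && substitutable x u q
  end.

(* The Esteva-Godo axioms of MTL. Disjunction is definable in MTL; as it is   *)
(* primitive here, the last two axioms state its definition.                  *)
Inductive mtl_axiom : formula L -> Prop :=
| ax_trans p q r : mtl_axiom ((p ==> q) ==> (q ==> r) ==> p ==> r)
| ax_tensl p q : mtl_axiom (p && q ==> p)
| ax_tensC p q : mtl_axiom (p && q ==> q && p)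
| ax_andl p q : mtl_axiom ((p /\ q) ==> p)
| ax_andC p q : mtl_axiom ((p /\ q) ==> (q /\ p))
| ax_div p q : mtl_axiom (p && (p ==> q) ==> (p /\ q))
| ax_uncurry p q r : mtl_axiom ((p ==> q ==> r) ==> p && q ==> r)
| ax_curry p q r : mtl_axiom ((p && q ==> r) ==> p ==> q ==> r)
| ax_prelin p q r :
    mtl_axiom (((p ==> q) ==> r) ==> ((q ==> p) ==> r) ==> r)
| ax_bot p : mtl_axiom (Bot ==> p)
| ax_or_def p q :
    mtl_axiom ((p \/ q) ==> (((p ==> q) ==> q) /\ ((q ==> p) ==> p)))
| ax_def_or p q :
    mtl_axiom ((((p ==> q) ==> q) /\ ((q ==> p) ==> p)) ==> (p \/ q)).

Inductive quantifier_axiom : formula L -> Prop :=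
| ax_forall_inst x t p : substitutable x t p ->
    quantifier_axiom (Forall x p ==> subst x t p)
| ax_exists_inst x t p : substitutable x t p ->
    quantifier_axiom (subst x t p ==> Exists x p)
| ax_forall_imp x p q : ~~ free x q ->
    quantifier_axiom (Forall x (q ==> p) ==> q ==> Forall x p)
| ax_exists_imp x p q : ~~ free x q ->
    quantifier_axiom (Forall x (p ==> q) ==> Exists x p ==> q)
| ax_forall_or x p q : ~~ free x q ->
    quantifier_axiom (Forall x (q \/ p) ==> (q \/ Forall x p)).

Inductive equality_axiom : formula L -> Prop :=
| ax_eq_refl x : equality_axiom (Equal (Var x) (Var x))
| ax_eq_subst x y p : substitutable x (Var y) p ->
    equality_axiom (Equal (Var x) (Var y) ==> p ==> subst x (Var y) p)
| ax_eq_crisp x y :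
    equality_axiom (Equal (Var x) (Var y) \/ (Equal (Var x) (Var y) ==> Bot)).

(* The predicate calculus MTL-forall with crisp equality.                     *)
Inductive derives (T : set (formula L)) : formula L -> Prop :=
| der_hyp p : T p -> derives T p
| der_mtl p : mtl_axiom p -> derives T p
| der_quantifier p : quantifier_axiom p -> derives T p
| der_equality p : equality_axiom p -> derives T p
| der_mp p q : derives T p -> derives T (p ==> q) -> derives T q
| der_gen x p : derives T p -> derives T (Forall x p).

Definition consistent (T : set (formula L)) : Prop := ~ derives T Bot.

(* The truth constant 0 counts as atomic. Without it every existential        *)
(* positive sentence would hold in the one-element structure whose predicates *)
(* are all constantly 1, and a theory that is consistent in MTL-forall but    *)
(* has no model over the given algebra could not be axiomatized.              *)
Definition atomic p : bool :=
  match p with Bot | Equal _ _ | Pred _ _ => true | _ => false end.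

Inductive positive_qf : formula L -> Prop :=
| pos_atomic p : atomic p -> positive_qf p
| pos_and p q : positive_qf p -> positive_qf q -> positive_qf (p /\ q)
| pos_or p q : positive_qf p -> positive_qf q -> positive_qf (p \/ q)
| pos_tens p q : positive_qf p -> positive_qf q -> positive_qf (p && q).

Definition existential_positive p : Prop :=
  exists (xs : seq nat) (q : formula L),
    positive_qf q /\ p = foldr (@Exists L) q xs.

End Syntax.

Record model_structure (L : language) (d : Order.disp_t)
    (A : finMTLChainType d) := ModelStructure {
  domain :> Type;
  domain_inhabited : inhabited domain;
  pred_interp : forall P : pred_symb L, ('I_(pred_arity P) -> domain) -> A;
  fun_interp : forall f : fun_symb L, ('I_(fun_arity f) -> domain) -> domain
}.

Section Semantics.
Variables (L : language) (d : Order.disp_t) (A : finMTLChainType d).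
Implicit Types (M N : model_structure L A) (T : set (formula L)).

Fixpoint teval M (v : nat -> M) (t : term L) : M :=
  match t with
  | Var x => v x
  | App f ts => fun_interp (fun i => teval v (ts i))
  end.

(* As A is a finite chain, the meet (join) of the nonempty set of values      *)
(* attained over the domain is its minimum (maximum).                         *)
Fixpoint eval M (v : nat -> M) (p : formula L) : A :=
  match p with
  | Bot => \bot
  | Equal t u => if `[< teval v t = teval v u >] then \top else \bot
  | Pred P ts => pred_interp (fun i => teval v (ts i))
  | And q r => Order.min (eval v q) (eval v r)
  | Or q r => Order.max (eval v q) (eval v r)
  | Tens q r => mtl_mul (eval v q) (eval v r)
  | Imp q r => mtl_imp (eval v q) (eval v r)
  | Forall x q =>
      \meet_(a : A | `[< exists m : M, eval [eta v with x |-> m] q = a >]) a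
  | Exists x q =>
      \join_(a : A | `[< exists m : M, eval [eta v with x |-> m] q = a >]) a
  end.

Definition satisfies M (p : formula L) : Prop :=
  forall v : nat -> M, eval v p = \top.

Definition Mod T M : Prop := forall p, T p -> satisfies M p.

Definition homomorphism M N (g : M -> N) : Prop :=
  (forall (f : fun_symb L) (ms : 'I_(fun_arity f) -> M),
     g (fun_interp ms) = fun_interp (fun i => g (ms i))) /\
  (forall (P : pred_symb L) (ms : 'I_(pred_arity P) -> M),
     pred_interp ms = \top -> pred_interp (fun i => g (ms i)) = \top).

Definition closed_under_homomorphisms
    (K : model_structure L A -> Prop) : Prop :=
  forall (M N : model_structure L A) (g : M -> N),
    K M -> homomorphism g -> K N.

End Semantics.

Arguments Mod {L d} A T.

(* Main.v *)
(* Existential positive sentences of value 1 are preserved by homomorphisms:  *)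
(* in a finite integral chain, max and the join of the attained values are 1  *)
(* iff some argument is 1, while min and mul are 1 iff both arguments are.    *)
(* Conversely, let N satisfy all existential positive consequences of T.      *)
(* Finite disjunctions of existential positive sentences being existential    *)
(* positive, an ultraproduct M of models of T satisfies T but no existential  *)
(* positive sentence failing in N. Every finite part of the positive diagram  *)
(* of M is thus realised in N, which yields a homomorphism from M to an       *)
(* ultrapower of N; the latter is then a model of T, and so is N by Los.      *)
Require Import Defs.
From mathcomp Require Import all_boot all_order.
From mathcomp Require Import boolp classical_sets filter.

Set Implicit Arguments.
Unset Strict Implicit.
Unset Printing Implicit Defensive.

Import Order.TTheory.

Local Open Scope classical_set_scope.
Local Open Scope order_scope.

(** Only the value 1 enters both [Mod] and [homomorphism], and on positive formulas it behaves
    classically over a nontrivial chain; [ep_sentence_hom] rests on this. The converse is a double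
    compactness argument over ultraproducts indexed by finite lists. [exists_ep_minor_model] glues
    models of T that refute finitely many sentences failing in N, and [ultrapower_hom] glues maps
    into N that respect finitely many facts. Finiteness of A gives [Los] for exact truth values, so
    theories pass up to ultraproducts and down from ultrapowers. *)

(** * The value 1 in a finite MTL-chain *)

Section ChainLemmas.
Variables (d : Order.disp_t) (A : finMTLChainType d).
Implicit Types a b : A.

Lemma mtl_mul_lel a b : mtl_mul a b <= a.
Proof.
rewrite mtl_mulC mtl_residuation (le_trans (lex1 b)) //.
by rewrite -mtl_residuation mtl_mul1x.
Qed.

Lemma mtl_mul_eq1 a b : (mtl_mul a b == \top) = (a == \top) && (b == \top).
Proof.
apply/eqP/andP => [ab1|[/eqP-> /eqP->]]; last by rewrite mtl_mul1x.
split; rewrite -le1x -ab1; first exact: mtl_mul_lel.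
by rewrite mtl_mulC mtl_mul_lel.
Qed.

Lemma max_eq1 a b : (Order.max a b == \top) = (a == \top) || (b == \top).
Proof. by rewrite -!le1x le_max. Qed.

Lemma min_eq1 a b : (Order.min a b == \top) = (a == \top) && (b == \top).
Proof. by rewrite -!le1x le_min. Qed.

(** Totality makes a finite nonempty join one of its arguments; nontriviality is needed for the
    empty join, which is [\bot]. *)
Lemma bigjoin_eq1 (P : pred A) :
  \bot <> \top :> A -> (\join_(a | P a) a == \top) = P \top.
Proof.
move=> A_nontriv; apply/idP/idP => [|P1]; last by rewrite -le1x joins_sup.
apply: contraLR => PN1; elim/big_ind: _ => [|a b aN1 bN1|a Pa].
- exact/eqP.
- by rewrite joinEtotal max_eq1 negb_or aN1.
- by apply: contraNneq PN1 => <-.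
Qed.

End ChainLemmas.

(** * Evaluation and preservation of existential positive sentences *)

Section Evaluation.
Variables (L : language) (d : Order.disp_t) (A : finMTLChainType d).
Implicit Types (M N : model_structure L A) (p q : formula L).

Lemma teval_occurs M (v w : nat -> M) (t : term L) :
  (forall x, occurs x t -> v x = w x) -> teval v t = teval w t.
Proof.
elim: t => [x|f ts IH] vw /=; first by apply: vw => /=.
congr fun_interp; apply/funext => i; apply: IH => x xi.
by apply: vw => /=; apply/existsP; exists i.
Qed.

Lemma eval_free M p (v w : nat -> M) :
  (forall x, free x p -> v x = w x) -> eval v p = eval w p.
Proof.
elim: p v w => [|t u|P ts|p IHp q IHq|p IHp q IHq|p IHp q IHq|p IHp q IHq|
    y p IHp|y p IHp] v w vw //=.
- by rewrite !(@teval_occurs _ v w) // => x xt; apply: vw; rewrite /= xt ?orbT.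
- congr pred_interp; apply/funext => i; apply: teval_occurs => x xi.
  by apply: vw => /=; apply/existsP; exists i.
- by rewrite (IHp v w) ?(IHq v w) // => x xp; apply: vw; rewrite /= xp ?orbT.
- by rewrite (IHp v w) ?(IHq v w) // => x xp; apply: vw; rewrite /= xp ?orbT.
- by rewrite (IHp v w) ?(IHq v w) // => x xp; apply: vw; rewrite /= xp ?orbT.
- by rewrite (IHp v w) ?(IHq v w) // => x xp; apply: vw; rewrite /= xp ?orbT.
- apply: eq_bigl => a; congr asbool; apply: eq_exists => m.
  rewrite (IHp _ [eta w with y |-> m]) // => x xp /=.
  by case: eqP => // /eqP xy; apply: vw; rewrite /= xy.
- apply: eq_bigl => a; congr asbool; apply: eq_exists => m.
  rewrite (IHp _ [eta w with y |-> m]) // => x xp /=.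
  by case: eqP => // /eqP xy; apply: vw; rewrite /= xy.
Qed.

Lemma sentence_satisfies M p (v : nat -> M) :
  sentence p -> eval v p = \top -> satisfies M p.
Proof.
by move=> sp vp w; rewrite -vp; apply: eval_free => x xp; case/negP: (sp x).
Qed.

Lemma free_closure x xs q :
  free x (foldr (@Exists L) q xs) = (x \notin xs) && free x q.
Proof. by elim: xs => //= y xs ->; rewrite inE negb_or andbA. Qed.

Section Nontrivial.
Hypothesis A_nontriv : \bot <> \top :> A.

Lemma eval_exists_eq1 M (v : nat -> M) x q :
  eval v (Exists x q) = \top <->
  exists m, eval [eta v with x |-> m] q = \top.
Proof.
split=> [/= /eqP|q1]; first by rewrite bigjoin_eq1 // => /asboolP.
by apply/eqP; rewrite /= bigjoin_eq1 //; apply/asboolP.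
Qed.

Lemma eval_closure_eq1 M (v : nat -> M) xs q :
  eval v (foldr (@Exists L) q xs) = \top <->
  exists w, (forall x, x \notin xs -> w x = v x) /\ eval w q = \top.
Proof.
elim: xs v => [|x xs IH] v.
  split=> [q1|[w [wv q1]]]; first by exists v.
  by have <- : w = v by apply/funext => x; apply: wv.
rewrite [foldr _ _ _]/= eval_exists_eq1.
split=> [[m /IH[w [wv q1]]]|[w [wv q1]]].
  exists w; split=> // y; rewrite inE negb_or => /andP[yx yxs].
  by rewrite wv //= (negPf yx).
(* If [x] is bound again in [xs], the inner quantifier overrides this value. *)
exists (w x); apply/IH; exists w; split=> // y yxs /=.
by case: eqP => [->//|/eqP yx]; apply: wv; rewrite inE negb_or yx.
Qed.

Lemma satisfies_closure M xs q : sentence (foldr (@Exists L) q xs) ->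
  satisfies M (foldr (@Exists L) q xs) <->
  exists v : nat -> M, eval v q = \top.
Proof.
move=> sq; have [m0] := domain_inhabited M; split=> [/(_ (fun=> m0))|[v q1]].
  by move=> /eval_closure_eq1[w [_ q1]]; exists w.
by apply: (sentence_satisfies (v := v)) => //; apply/eval_closure_eq1; exists v.
Qed.

Lemma satisfies_Bot M : ~ satisfies M Bot.
Proof. by have [m0] := domain_inhabited M => /(_ (fun=> m0)). Qed.

End Nontrivial.

Lemma teval_hom M N (g : M -> N) (v : nat -> M) t :
  homomorphism g -> teval (g \o v) t = g (teval v t).
Proof.
move=> [gF _]; elim: t => //= f ts IH; rewrite gF.
by congr fun_interp; apply/funext.
Qed.

(** The induction only ever needs the value 1 of subformulas: each positive connective has value 1
    according to which arguments have value 1. Smaller values need not be preserved. *)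
Lemma eval_hom_eq1 M N (g : M -> N) (v : nat -> M) q :
  homomorphism g -> positive_qf q -> eval v q = \top ->
  eval (g \o v) q = \top.
Proof.
move=> gh; elim=> {q} [q|p q _ IHp _ IHq|p q _ IHp _ IHq|p q _ IHp _ IHq].
- case: q => //= [t u _|P ts _].
    by rewrite !teval_hom //; case: asboolP => [->|_]; case: asboolP.
  by move=> /gh.2; under eq_fun do rewrite -teval_hom //.
- move=> /eqP /=; rewrite min_eq1 => /andP[/eqP/IHp-> /eqP/IHq->].
  by apply/eqP; rewrite min_eq1 !eqxx.
- move=> /eqP /=; rewrite max_eq1.
  by case/orP=> [/eqP/IHp->|/eqP/IHq->]; apply/eqP; rewrite max_eq1 eqxx ?orbT.
- move=> /eqP /=; rewrite mtl_mul_eq1 => /andP[/eqP/IHp-> /eqP/IHq->].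
  by apply/eqP; rewrite mtl_mul_eq1 !eqxx.
Qed.

Definition ep_sentence p := sentence p /\ existential_positive p.

Lemma ep_sentence_Bot : ep_sentence Bot.
Proof. by split=> //; exists [::], Bot; split=> //; apply: pos_atomic. Qed.

(* No renaming is needed to prenex: both disjuncts are sentences, so merging  *)
(* their quantifier prefixes captures nothing that matters in a nonempty      *)
(* domain.                                                                    *)
Lemma ep_sentence_or p q :
  \bot <> \top :> A -> ep_sentence p -> ep_sentence q ->
  exists r, ep_sentence r /\
    forall M, satisfies M r <-> satisfies M p \/ satisfies M q.
Proof.
move=> A_nontriv [sp [xs [p' [pp' pE]]]] [sq [ys [q' [pq' qE]]]].
pose r := foldr (@Exists L) (Or p' q') (xs ++ ys).
have sr : sentence r.
  move=> x; rewrite free_closure mem_cat negb_or /=.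
  move: (sp x) (sq x); rewrite pE qE !free_closure.
  by do 2 case: (_ \in _) => //=; do 2 case: free.
exists r; split=> [|M].
  by split=> //; exists (xs ++ ys), (Or p' q'); split=> //; apply: pos_or.
move: sp sq; rewrite pE qE => sp sq; rewrite !satisfies_closure //.
split=> [[v /eqP]|[[v v1]|[v v1]]].
- by rewrite /= max_eq1 => /orP[]/eqP v1; [left|right]; exists v.
- by exists v; apply/eqP; rewrite /= max_eq1 v1 eqxx.
- by exists v; apply/eqP; rewrite /= max_eq1 v1 eqxx orbT.
Qed.

(** This lets compactness treat finitely many failing sentences as one. The empty disjunction is
    [Bot], available because [Bot] is atomic. [{classic formula L}] supplies the decidable equality
    behind list membership. *)
Lemma ep_sentence_bigor (s : seq {classic formula L}) : \bot <> \top :> A ->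
  (forall p : {classic formula L}, p \in s -> ep_sentence p) ->
  exists r, ep_sentence r /\
    forall M, satisfies M r <->
      exists2 p : {classic formula L}, p \in s & satisfies M p.
Proof.
move=> A_nontriv; elim: s => [_|p s IH eps].
  exists Bot; split=> [|M]; first exact: ep_sentence_Bot.
  by split=> [/satisfies_Bot|[]].
have [r [epr rE]] : exists r, ep_sentence r /\
    forall M, satisfies M r <->
      exists2 p : {classic formula L}, p \in s & satisfies M p.
  by apply: IH => q qs; apply: eps; rewrite inE qs orbT.
have [r' [epr' r'E]] := ep_sentence_or A_nontriv (eps p (mem_head _ _)) epr.
exists r'; split=> // M; rewrite r'E rE; split=> [[Mp|[q qs Mq]]|[q]].
- by exists p; rewrite ?mem_head.
- by exists q => //; rewrite inE qs orbT.
- by rewrite inE => /orP[/eqP->|qs] Mq; [left|right; exists q].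
Qed.

Lemma ep_sentence_hom M N (g : M -> N) p : \bot <> \top :> A ->
  homomorphism g -> ep_sentence p -> satisfies M p -> satisfies N p.
Proof.
move=> A_nontriv gh [sp [xs [q [pq pE]]]]; move: sp; rewrite pE => sp.
rewrite !satisfies_closure // => -[v v1].
by exists (g \o v); apply: eval_hom_eq1.
Qed.

End Evaluation.

(** * Ultrafilters on finite lists and limits in a finite set *)

Lemma exists_fine_ultrafilter (X : eqType) :
  exists U : set_system (seq X),
    UltraFilter U /\ forall x, \forall s \near U, x \in s.
Proof.
(* The filter generated by the cones of lists containing [s0]; concatenation shows that two cones
   meet in a cone. *)
pose F : set_system (seq X) :=
  [set P | exists s0 : seq X, forall s, {subset s0 <= s} -> P s].
have FF : ProperFilter F.
  split; first by move=> [s0 /(_ s0)]; apply.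
  split=> [|P Q [s1 Ps1] [s2 Qs2]|P Q PQ [s0 Ps0]].
  - by exists [::].
  - exists (s1 ++ s2) => s s12; split; [apply: Ps1|apply: Qs2] => x xs;
      by apply: s12; rewrite mem_cat xs ?orbT.
  - by exists s0 => s /Ps0/PQ.
have [U [UU FU]] := ultraFilterLemma FF.
exists U; split=> // x; apply: FU; exists [:: x] => s; apply.
exact: mem_head.
Qed.

(** Otherwise U would contain the complements of all fibres of [f], finitely many sets with empty
    intersection. *)
Lemma ultra_lim (I : Type) (U : set_system I) (A : finType) (f : I -> A) :
  UltraFilter U -> exists a, \forall i \near U, f i = a.
Proof.
move=> UU; apply: contrapT => /forallNP noa.
have : \forall i \near U, forall a, f i <> a.
  apply: filter_forall => a.
  by have [] := in_ultra_setVsetC [set i | f i = a] UU => // /noa.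
by move=> /filter_ex[i /(_ (f i))].
Qed.

(** * Ultraproducts of structures and the theorem of Los *)

Section Ultraproduct.
Variables (L : language) (d : Order.disp_t) (A : finMTLChainType d).
Variables (I : Type) (U : set_system I) (UU : UltraFilter U).
Variable M : I -> model_structure L A.

Let E (f g : forall i, M i) : Prop := \forall i \near U, f i = g i.

(** The quotient by equality U-almost everywhere: classes are predicates, so extensionality
    identifies equal ones. *)
Definition ultra_dom := {C : (forall i, M i) -> Prop | exists f, C = E f}.

Definition ultra_class f : ultra_dom := exist _ (E f) (ex_intro _ f erefl).

Definition ultra_repr (c : ultra_dom) : forall i, M i :=
  projT1 (cid (proj2_sig c)).

Lemma ultra_reprK c : ultra_class (ultra_repr c) = c.
Proof.
rewrite /ultra_repr; case: cid => f; case: c => C Cf /= CE.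
exact: eq_exist.
Qed.

Lemma ultra_classP f g : ultra_class f = ultra_class g <-> E f g.
Proof.
split=> [[/(congr1 (@^~ g))] /= ->|fg]; first exact: nearW.
apply: eq_exist => /=; apply/funext => h; apply/propext.
by rewrite /E; split; apply: filterS2 fg => i ->.
Qed.

Lemma ultra_classK f : \forall i \near U, ultra_repr (ultra_class f) i = f i.
Proof. by apply/ultra_classP; rewrite ultra_reprK. Qed.

Lemma ultra_dom_inhabited : inhabited ultra_dom.
Proof.
have M_inh i : exists m : M i, True.
  by have [m] := domain_inhabited (M i); exists m.
exact: (inhabits (ultra_class (fun i => projT1 (cid (M_inh i))))).
Qed.

Definition ultraproduct : model_structure L A :=
  @ModelStructure L d A ultra_dom ultra_dom_inhabited
    (fun P cs => projT1 (cid (ultra_lim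
      (fun i => pred_interp (fun k => ultra_repr (cs k) i)) UU)))
    (fun f cs => ultra_class
      (fun i => fun_interp (fun k => ultra_repr (cs k) i))).

Let cls (f : forall i, M i) : ultraproduct := ultra_class f.

(** Independence of the representatives chosen by [ultra_repr]; finite arity lets the
    almost-everywhere equalities be intersected. *)
Lemma ultra_fun_interp (f : fun_symb L)
    (ms : 'I_(fun_arity f) -> forall i, M i) :
  fun_interp (fun k => cls (ms k)) = cls (fun i => fun_interp (ms^~ i)).
Proof.
apply/ultra_classP; have /filter_forall : forall k, \forall i \near U,
    ultra_repr (cls (ms k)) i = ms k i by move=> k; apply: ultra_classK.
apply: filterS => i msi; by congr fun_interp; apply/funext.
Qed.

Lemma ultra_pred_interp (P : pred_symb L)
    (ms : 'I_(pred_arity P) -> forall i, M i) :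
  \forall i \near U, pred_interp (ms^~ i) = pred_interp (fun k => cls (ms k)).
Proof.
have /filter_forall : forall k, \forall i \near U,
    ultra_repr (cls (ms k)) i = ms k i by move=> k; apply: ultra_classK.
rewrite /=; case: cid => a /=; apply: filterS2 => i <- msi.
by congr pred_interp; apply/funext.
Qed.

Lemma ultra_teval (v : nat -> forall i, M i) t :
  teval (fun x => cls (v x)) t = cls (fun i => teval (v^~ i) t).
Proof.
elim: t => //= f ts IH.
rewrite -(ultra_fun_interp (fun k i => teval (v^~ i) (ts k))).
by congr (@fun_interp _ _ _ ultraproduct f _); apply/funext.
Qed.

(* As A is finite it is enough to check the values one at a time.             *)
Lemma ultra_attained (v : nat -> forall i, M i) x q :
  (forall v : nat -> forall i, M i, \forall i \near U,
     eval (v^~ i) q = eval (fun x => cls (v x)) q) ->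
  \forall i \near U, forall a : A,
    `[< exists m : M i, eval [eta v^~ i with x |-> m] q = a >] =
    `[< exists m, eval [eta (fun x => cls (v x)) with x |-> m] q = a >].
Proof.
move=> IH; apply: filter_forall => a.
have {}IH (f : forall i, M i) : \forall i \near U,
    eval [eta v^~ i with x |-> f i] q =
    eval [eta (fun x => cls (v x)) with x |-> cls f] q.
  have := IH [eta v with x |-> f]; apply: filterS => i.
  have -> : (fun y => cls ([eta v with x |-> f] y)) =
            [eta (fun x => cls (v x)) with x |-> cls f].
    by apply/funext => y /=; case: eqP.
  by move=> <-; congr eval; apply/funext => y /=; case: eqP.
case: (asboolP (exists m, eval _ q = a)) => [[c ca]|noc].
  have := IH (ultra_repr c); apply: filterS => i; rewrite [cls _]ultra_reprK ca.
  by move=> ia; apply/asboolP; exists (ultra_repr c i).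
have [|//] := in_ultra_setVsetC
  [set i | exists m : M i, eval [eta v^~ i with x |-> m] q = a] UU; last first.
  by apply: filterS => i /= noi; apply/asboolPn.
move=> exm; exfalso.
(* Coordinates without a witness get an arbitrary element; by [exm] they are negligible. *)
have wit i : exists m : M i,
    (exists m : M i, eval [eta v^~ i with x |-> m] q = a) ->
    eval [eta v^~ i with x |-> m] q = a.
  have [[m ma]|nom] :=
    pselect (exists m : M i, eval [eta v^~ i with x |-> m] q = a).
    by exists m.
  by have [m] := domain_inhabited (M i); exists m.
pose f i := projT1 (cid (wit i)).
have [i [fi ie]] := filter_ex (filterI (IH f) exm).
by apply: noc; exists (cls f); rewrite -fi; exact: (projT2 (cid (wit i))).
Qed.

(** In the quantifier cases, almost every coordinate attains exactly the values attained in the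
    ultraproduct, so the meets and joins range over the same set. *)
Theorem Los (v : nat -> forall i, M i) p :
  \forall i \near U, eval (v^~ i) p = eval (fun x => cls (v x)) p.
Proof.
elim: p v => [|t u|P ts|p IHp q IHq|p IHp q IHq|p IHp q IHq|p IHp q IHq|
    y p IHp|y p IHp] v /=.
- exact: nearW.
- rewrite !ultra_teval; case: asboolP => [/ultra_classP|neq].
    by apply: filterS => i ->; rewrite asboolT.
  have [/ultra_classP//|] := in_ultra_setVsetC
    [set i | teval (v^~ i) t = teval (v^~ i) u] UU.
  by apply: filterS => i ne; rewrite asboolF.
- have := @ultra_pred_interp P (fun k i => teval (v^~ i) (ts k)).
  apply: filterS => i ->; congr pred_interp.
  by apply/funext => k; rewrite ultra_teval.
- by apply: filterS2 (IHp v) (IHq v) => i -> ->.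
- by apply: filterS2 (IHp v) (IHq v) => i -> ->.
- by apply: filterS2 (IHp v) (IHq v) => i -> ->.
- by apply: filterS2 (IHp v) (IHq v) => i -> ->.
- by apply: filterS (ultra_attained v y IHp) => i vE; apply: eq_bigl.
- by apply: filterS (ultra_attained v y IHp) => i vE; apply: eq_bigl.
Qed.

Lemma Mod_ultraproduct T : (forall i, Mod A T (M i)) -> Mod A T ultraproduct.
Proof.
move=> MT p Tp v.
have -> : v = fun x => cls (ultra_repr (v x)).
  by apply/funext => x; rewrite [cls _]ultra_reprK.
have /filter_ex[i <-] := Los (fun x => ultra_repr (v x)) p.
exact: MT.
Qed.

End Ultraproduct.

(** Los is applied to the diagonal assignment, constant in each variable. *)
Lemma Mod_ultrapower (L : language) (d : Order.disp_t) (A : finMTLChainType d)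
    (I : Type) (U : set_system I) (UU : UltraFilter U)
    (N : model_structure L A) (T : set (formula L)) :
  Mod A T (ultraproduct UU (fun=> N)) -> Mod A T N.
Proof.
move=> NT p Tp v; have /filter_ex[i ->] := Los UU (fun x (_ : I) => v x) p.
exact: NT.
Qed.

(** * Compactness arguments for the converse *)

Section Preservation.
Variables (L : language) (d : Order.disp_t) (A : finMTLChainType d).
Hypothesis A_nontriv : \bot <> \top :> A.
Implicit Types (M N : model_structure L A) (T : set (formula L)).

Lemma exists_ep_minor_model T N :
  (forall p, ep_sentence p -> (forall M, Mod A T M -> satisfies M p) ->
     satisfies N p) ->
  exists M, Mod A T M /\
    forall p, ep_sentence p -> satisfies M p -> satisfies N p.
Proof.
move=> Nep.
have /choice[K KP] (s : seq {classic formula L}) : exists M, Mod A T M /\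
    forall p : {classic formula L},
      p \in s -> ep_sentence p -> ~ satisfies N p -> ~ satisfies M p.
  pose s' := [seq p : {classic formula L} <- s |
                `[< ep_sentence p /\ ~ satisfies N p >]].
  have [|r [epr rE]] := @ep_sentence_bigor L d A s' A_nontriv.
    by move=> p; rewrite mem_filter => /andP[/asboolP[]].
  apply: contrapT => /forallNP noM.
  (* If every model of T satisfied some sentence of [s'], then [r] would be a consequence of T and
     hold in N, although each disjunct fails there. *)
  have /rE[p] : satisfies N r.
    apply: Nep => // M TM; apply: contrapT => nMr; apply: (noM M).
    split=> // p ps epp nNp Mp; apply: nMr; apply/rE; exists p => //.
    by rewrite mem_filter ps andbT; apply/asboolP.
  by rewrite mem_filter => /andP[/asboolP[]].
have [U [UU Uin]] := exists_fine_ultrafilter {classic formula L}.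
exists (ultraproduct UU K); split=> [|p epp Up].
  by apply: Mod_ultraproduct => s; case: (KP s).
apply: contrapT => nNp.
have [c] := ultra_dom_inhabited U K.
have [s [ps sE]] :=
  filter_ex (filterI (Uin p) (Los UU (fun=> ultra_repr c) p)).
have [_ /(_ p ps epp nNp)] := KP s; apply.
exact: sentence_satisfies epp.1 (etrans sE (Up _)).
Qed.

(* The positive diagram of M.                                                 *)
Inductive fact M : Type :=
| PredFact (P : pred_symb L) (ms : 'I_(pred_arity P) -> M)
    of pred_interp ms = \top
| FunFact (f : fun_symb L) of ('I_(fun_arity f) -> M).

Definition preserves M N (h : M -> N) (F : fact M) : Prop :=
  match F with
  | PredFact P ms _ => pred_interp (h \o ms) = \top
  | FunFact f ms => h (fun_interp ms) = fun_interp (h \o ms)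
  end.

Definition fact_elements M (F : fact M) : seq {classic M} :=
  match F with
  | PredFact P ms _ => codom ms
  | FunFact f ms => fun_interp ms :: codom ms
  end.

Definition fact_formula M (var : M -> nat) (F : fact M) : formula L :=
  match F with
  | PredFact P ms _ => Pred (fun k => Var (var (ms k)))
  | FunFact f ms =>
      Equal (Var (var (fun_interp ms))) (App (fun k => Var (var (ms k))))
  end.

Lemma eval_fact_formula M N (var : M -> nat) (w : nat -> N) (F : fact M) :
  eval w (fact_formula var F) = \top <-> preserves (w \o var) F.
Proof. by case: F => [P ms _|f ms] //=; case: asboolP. Qed.

(** Existentially quantifying the elements in a finite part of the diagram gives an existential
    positive sentence true in M; its witnesses in N define [h]. *)
Lemma partial_hom M N (s : seq {classic fact M}) :
  (forall p, ep_sentence p -> satisfies M p -> satisfies N p) ->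
  exists h : M -> N, forall F : {classic fact M}, F \in s -> preserves h F.
Proof.
move=> MN; have [m0] := domain_inhabited M.
pose E := flatten [seq fact_elements F | F : {classic fact M} <- s].
(* Elements outside [E] all share the index [size E]; no fact in [s] mentions them. *)
pose var (m : M) := index (m : {classic M}) E.
(* The trivial equation stands for the empty conjunction. The prefix below has one variable more
   than [E], so [Var 0] is bound even when [E] is empty. *)
pose q := foldr (@And L) (Equal (Var 0) (Var 0))
  [seq fact_formula var F | F : {classic fact M} <- s].
have qE (K : model_structure L A) (v : nat -> K) : eval v q = \top <->
    forall F : {classic fact M}, F \in s -> preserves (v \o var) F.
  rewrite /q; elim: (s) => [|F s' IH]; first by rewrite /= asboolT.
  split=> [/eqP|vs'].
    rewrite /= min_eq1 => /andP[/eqP/eval_fact_formula vF /eqP/IH vs'] G.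
    by rewrite inE => /orP[/eqP->|/vs'].
  apply/eqP; rewrite /= min_eq1; apply/andP; split; apply/eqP.
    by apply/eval_fact_formula; apply: vs'; rewrite mem_head.
  by apply/IH => G Gs'; apply: vs'; rewrite inE Gs' orbT.
have var_le m : (var m < (size E).+1)%N by rewrite ltnS index_size.
pose p := foldr (@Exists L) q (iota 0 (size E).+1).
have sp : sentence p.
  move=> x; rewrite /p free_closure negb_and negbK mem_iota leq0n add0n.
  rewrite orbC -implybE; apply/implyP; rewrite /q.
  elim: (s) => [/orP[]/eqP->//|F s' IH] /= /orP[|/IH//].
  by case: F => [P ms _|f ms] /=; [|case/orP=> [/eqP->//|]];
    move=> /existsP[k /eqP->].
have epp : ep_sentence p.
  split=> //; exists (iota 0 (size E).+1), q; split=> //; rewrite /q.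
  elim: (s) => [|F s' IH] /=; first exact: pos_atomic.
  by apply: pos_and => //; apply: pos_atomic; case: F.
have : satisfies M p.
  apply/(satisfies_closure A_nontriv M sp); exists (nth (m0 : {classic M}) E).
  apply/qE => F Fs; have varK m : m \in fact_elements F ->
      nth (m0 : {classic M}) E (var m) = m.
    move=> mF; apply: nth_index; apply/flattenP.
    by exists (fact_elements F) => //; apply: map_f.
  case: F Fs varK => [P ms ms1|f ms] _ varK /=.
    by rewrite -ms1; congr pred_interp; apply/funext => k; apply/varK/codom_f.
  rewrite varK ?mem_head //; congr fun_interp; apply/funext => k.
  by rewrite /= varK // inE codom_f orbT.
move=> /(MN p epp)/(satisfies_closure A_nontriv N sp)[w /qE wP].
by exists (w \o var).
Qed.

(** The partial maps need not cohere: each fact lies in almost every list [s], so the class of [s]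
    mapped to [h s m] respects all facts at once. *)
Lemma ultrapower_hom M N :
  (forall p, ep_sentence p -> satisfies M p -> satisfies N p) ->
  exists (I : Type) (U : set_system I) (UU : UltraFilter U)
    (g : M -> ultraproduct UU (fun=> N)), homomorphism g.
Proof.
move=> MN; have /choice[h hP] (s : seq {classic fact M}) := partial_hom s MN.
have [U [UU Uin]] := exists_fine_ultrafilter {classic fact M}.
exists _, U, UU, (fun m => ultra_class U (fun s => h s m)).
split=> [f ms|P ms ms1].
  rewrite ultra_fun_interp; apply/ultra_classP.
  by apply: filterS (Uin (FunFact ms)) => s /hP.
have [s [/hP/= <- <-]] := filter_ex (filterI (Uin (PredFact ms1))
  (ultra_pred_interp UU (fun k s => h s (ms k)))).
by [].
Qed.

End Preservation.

Theorem theorem5p3 (d : Order.disp_t) (A : finMTLChainType d) (L : language)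
    (T : set (formula L)) :
  is_theory T -> consistent T ->
  (closed_under_homomorphisms (Mod A T) <->
   exists S : set (formula L),
     (forall p, S p -> sentence p /\ existential_positive p) /\
     Mod A T = Mod A S).
Proof.
move=> _ _; have [A_triv|A_nontriv] := pselect (\bot = \top :> A).
  (* Over the trivial algebra every structure is a model of every theory, so the empty set
     axiomatizes T. *)
  have all1 (a : A) : a = \top by apply/eqP; rewrite -le1x -A_triv le0x.
  by split=> [_|_ M N g _ _ p _ v]; first exists set0; rewrite ?all1 //;
    split=> //; apply/funext => M; apply/propext; split=> _ p _ v; apply: all1.
split=> [Tclosed|[S [epS ->]] M N g MS gh p Sp]; last first.
  exact: (ep_sentence_hom A_nontriv gh (epS p Sp) (MS p Sp)).
(* All existential positive consequences of T over A. *)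
exists [set p | ep_sentence p /\ forall M, Mod A T M -> satisfies M p].
split=> [p []//|]; apply/funext => N; apply/propext; split=> [TN p [_]|NS].
  exact.
have [|M [TM MN]] := @exists_ep_minor_model L d A A_nontriv T N.
  by move=> p epp Tp; apply: NS.
have [I [U [UU [g gh]]]] := ultrapower_hom A_nontriv MN.
exact: (Mod_ultrapower (Tclosed _ _ _ TM gh)).
Qed.
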